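(* Let $a$ and $b$ be different positive integers with $\gcd(a,b)=1$. Then there are no positive integers $n,x$ with $n$ even such that $(a^{n}-2)(b^{n}-2)=x^{2}$. *)

(* Defs.v *)
From mathcomp Require Export all_boot all_order all_algebra.

(* Main.v *)
(** Write A = a^m and B = b^m with n = 2m, so that (A^2 - 2)(B^2 - 2) = x^2.
    If A^2 - 2 = d u^2 and B^2 - 2 = d v^2, multiplying A + u sqrt d by the unit
    (B - v sqrt d)^2 / 2 gives another solution of X^2 - d Y^2 = 2.  As
    d u v = x, its first coordinate A (B^2 - 1) - B x does not involve d; it is
    congruent to -A modulo B, and smaller than A in absolute value when B < A.
    Hence coprime solutions descend indefinitely. *)
Require Import Defs.
From mathcomp Require Import all_boot all_order all_algebra.
From mathcomp Require Import zify ring.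

Set Implicit Arguments.
Unset Strict Implicit.
Unset Printing Implicit Defensive.

Import Order.TTheory GRing.Theory Num.Theory.
Local Open Scope ring_scope.

(** With [D = B ^+ 2 - 2], the equation says that [x + A sqrt D] has norm [-2 D]. Multiplying by
    [B ^+ 2 - 1 - B sqrt D], of norm 1, preserves this. [A'] can be negative, hence the absolute
    values. *)
Lemma sqr_sub2_descent (A B x : int) :
    1 < B -> B < A -> 0 <= x -> (A ^+ 2 - 2) * (B ^+ 2 - 2) = x ^+ 2 ->
  let A' := A * (B ^+ 2 - 1) - B * x in
  [/\ 1 < `|A'|, `|A'| < A, coprimez `|A'| B = coprimez A B
    & (`|A'| ^+ 2 - 2) * (B ^+ 2 - 2)
      = (x * (B ^+ 2 - 1) - A * B * (B ^+ 2 - 2)) ^+ 2].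
Proof.
move=> B1 BA x0 eqx A'.
have eqx' : (A' ^+ 2 - 2) * (B ^+ 2 - 2)
    = (x * (B ^+ 2 - 1) - A * B * (B ^+ 2 - 2)) ^+ 2.
  apply/eqP; rewrite -subr_eq0 /A'.
  have -> : ((A * (B ^+ 2 - 1) - B * x) ^+ 2 - 2) * (B ^+ 2 - 2)
      - (x * (B ^+ 2 - 1) - A * B * (B ^+ 2 - 2)) ^+ 2
    = (A ^+ 2 - 2) * (B ^+ 2 - 2) - x ^+ 2 by ring.
  by rewrite eqx subrr.
have B0 : 0 < B by exact: lt_trans B1.
have A0 : 0 < A by exact: lt_trans BA.
have AB0 : 0 < A * B by exact: mulr_gt0.
have Bx0 : 0 <= B * x by rewrite mulr_ge0 // ltW.
have B2 : 0 < B ^+ 2 - 2 by clear -B1; nia.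
split.
(* A square divided by [B ^+ 2 - 2 > 0] is nonnegative, so [A' ^+ 2] is at least 2. *)
- have : 0 <= (A' ^+ 2 - 2) * (B ^+ 2 - 2) by rewrite eqx' sqr_ge0.
  rewrite pmulr_lge0 // subr_ge0 ltNge -(real_normK (num_real A')) => le2.
  apply/negP => le1; have := le_trans le2 (exprn_ile1 2 (normr_ge0 A') le1).
  by [].
- have xlt : x < A * B.
    rewrite -(ltr_pXn2r (n := 2)) ?nnegrE //; last exact: ltW.
    rewrite -eqx -subr_gt0.
    have -> : (A * B) ^+ 2 - (A ^+ 2 - 2) * (B ^+ 2 - 2)
      = 2 * (A ^+ 2 + (B ^+ 2 - 2)) by ring.
    by rewrite mulr_gt0 // ltr_wpDl // sqr_ge0.
  (* Squared and divided by [B ^+ 2 - 2], this reduces to [B ^+ 2 < A ^+ 2]. It yields [A' < A], as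
     [xlt] yields [- A < A']. *)
  have xgt : A * (B ^+ 2 - 2) < B * x.
    rewrite -(ltr_pXn2r (n := 2)) ?nnegrE //; last by rewrite mulr_ge0 ?ltW.
    rewrite [ltRHS]exprMn -eqx exprMn -subr_gt0.
    have -> : B ^+ 2 * ((A ^+ 2 - 2) * (B ^+ 2 - 2))
        - A ^+ 2 * (B ^+ 2 - 2) ^+ 2
      = 2 * (B ^+ 2 - 2) * ((A - B) * (A + B)) by ring.
    apply: mulr_gt0; first by apply: mulr_gt0.
    by rewrite mulr_gt0 ?subr_gt0 ?addr_gt0.
  rewrite ltr_norml -subr_gt0 -[A' < A]subr_gt0; apply/andP; split.
    have -> : A' - - A = B * (A * B - x) by rewrite /A'; ring.
    by rewrite mulr_gt0 ?subr_gt0.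
  have -> : A - A' = B * x - A * (B ^+ 2 - 2) by rewrite /A'; ring.
  by rewrite subr_gt0.
- rewrite /coprimez gcdzC [gcdz A B]gcdzC.
  have -> : gcdz B `|A'| = gcdz B A' by rewrite /gcdz absz_id.
  have -> : A' = (A * B - x) * B + - A by rewrite /A'; ring.
  by rewrite gcdzMDl gcdzN.
- by rewrite real_normK ?num_real.
Qed.

(** Descent on [A + B], replacing the larger entry. Both entries stay above 1, so it can only stop
    at [A = B], where the gcd is [A > 1]; each step keeps coprimality unchanged. *)
Lemma sqr_sub2_mul_square_Ncoprime (A B x : int) :
    1 < A -> 1 < B -> (A ^+ 2 - 2) * (B ^+ 2 - 2) = x ^+ 2 ->
  ~~ coprimez A B.
Proof.
have [N leN] : exists N : nat, A + B < N%:Z.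
  by exists `|A + B|.+1; lia.
elim: N A B x leN => [|N IH] A B x leN A1 B1; first by lia.
wlog x0 : x / 0 <= x => [wlx eqx|].
  by apply: (wlx `|x|); rewrite ?normr_ge0 // real_normK ?num_real.
wlog BA : A B leN A1 B1 / B <= A => [wlBA eqx|eqx].
  have [BA|AB] := leP B A; first exact: wlBA eqx.
  rewrite coprimez_sym.
  by apply: wlBA; rewrite ?(ltW AB) ?[B + A]addrC // mulrC.
have [eqAB|/eqP neAB] := A =P B.
  by rewrite eqAB /coprimez gcdzz; lia.
have ltBA : B < A by lia.
have [lb ub <- eqx'] := sqr_sub2_descent B1 ltBA x0 eqx.
by apply: IH eqx' => //; lia.
Qed.

(* MathComp; the equation is stated in int, since subtraction on nat truncates. *)
Theorem theorem23 (a b : nat) (ha : (0 < a)%N) (hb : (0 < b)%N)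
    (hab : a <> b) (hgcd : gcdn a b = 1%N) :
  ~ exists n x : nat,
      [/\ (0 < n)%N, (0 < x)%N, ~~ odd n
        & ((a%:Z ^+ n - 2) * (b%:Z ^+ n - 2) = x%:Z ^+ 2)%R].
Proof.
case=> n [x [n0 x0 evn]].
have PoszX (c k : nat) : c%:Z ^+ k = (c ^ k)%N%:Z by rewrite -!natz natrX.
rewrite -(even_halfK evn) -muln2 !exprM (PoszX a) (PoszX b).
set m := n./2; have m0 : (0 < m)%N by rewrite /m; lia.
have cop : coprime (a ^ m) (b ^ m).
  by rewrite coprimeXl ?coprimeXr // /coprime hgcd.
have neq : (a ^ m)%N <> (b ^ m)%N by move/eqP; rewrite eqn_exp2r // => /eqP.
have A0 : (0 < a ^ m)%N by rewrite expn_gt0 ha.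
have B0 : (0 < b ^ m)%N by rewrite expn_gt0 hb.
move: (a ^ m)%N (b ^ m)%N cop neq A0 B0 => A B cop neq A0 B0 eqx.
wlog leAB : A B cop neq A0 B0 eqx / (A <= B)%N => [wlAB|].
  have [leAB|leBA] := leqP A B; first exact: (wlAB A B).
  apply: (wlAB B A _ _ B0 A0 _ (ltnW leBA)); first by rewrite coprime_sym.
    exact: nesym.
  by rewrite mulrC.
have B1 : (1 < B)%N by lia.
(* The descent needs both entries above 1. If [A = 1], the factors are -1 and at least 2, so their
   product is no square. *)
have [A1|A1] := leqP A 1.
  have : 0 <= (A%:Z ^+ 2 - 2) * (B%:Z ^+ 2 - 2) by rewrite eqx sqr_ge0.
  have -> : A = 1%N by lia.
  by move: B1; clear; nia.
by have /negP[] := sqr_sub2_mul_square_Ncoprime (A := A) (B := B) A1 B1 eqx.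
Qed.
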